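(* Let $X$ be an infinite Hausdorff Lindelöf Fréchet space. Then the games $\operatorname{PONAG}(X)$ and $\operatorname{M}(X)$ are equivalent, that is: Alice has a winning strategy in $\operatorname{PONAG}(X)$ if and only if Alice has a winning strategy in $\operatorname{M}(X)$, and Bob has a winning strategy in $\operatorname{PONAG}(X)$ if and only if Bob has a winning strategy in $\operatorname{M}(X)$.
   Context: A space is Lindelöf if every open cover has a countable subcover (regularity is not assumed). A space $X$ is Fréchet if for every $A\subseteq X$ and $p\in\overline{A}$ there is a sequence in $A$ converging to $p$. Menger game $\operatorname{M}(X)$: two players, Alice and Bob, play an inning for each $n\in\omega$. In round $n$ Alice plays an open cover $\mathcal{U}_n$ of $X$ and Bob replies with a finite set $\mathcal{F}_n\subseteq\mathcal{U}_n$. Bob wins if $\bigcup_{n\in\omega}\mathcal{F}_n$ covers $X$; otherwise Alice wins. A partial open neighborhood assignment in $X$ is a family $\{V_x: x\in Y\}$, where $Y\subseteq X$ and each $V_x$ is an open neighborhood of $x$ in $X$. For $D\subseteq Y$ put $V_D:=\bigcup_{x\in D}V_x$. Partial open neighborhood assignment game $\operatorname{PONAG}(X)$: two players, Alice and Bob, play an inning for each $n\in\omega$. In round $0$, Alice plays a partial open neighborhood assignment $\{V^0_x: x\in Y_0\}$ with $Y_0\subseteq X$ that covers $X$, and Bob replies with a set $D_0\subseteq Y_0$ that is closed and discrete in $X$. In round $n>0$, Alice plays a partial open neighborhood assignment $\{V^n_x: x\in Y_n\}$ in $X$ such that $Y_n\subseteq X\setminus\bigcup_{k<n}V^k_{D_k}$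 and the family covers $X\setminus\bigcup_{k<n}V^k_{D_k}$; Bob replies with a set $D_n\subseteq Y_n$ that is closed and discrete in $X$. Here $V^k_{D_k}=\bigcup_{x\in D_k}V^k_x$. Bob wins if $\bigcup_{n\in\omega}\{V^n_x: x\in D_n\}$ covers $X$; otherwise Alice wins. *)

(* Defs.v *)
From mathcomp Require Import all_boot.
From mathcomp Require Import all_classical.
From mathcomp Require Import topology.

Set Implicit Arguments.
Unset Strict Implicit.
Unset Printing Implicit Defensive.

Local Open Scope classical_set_scope.

Definition open_cover (X : topologicalType) (U : set (set X)) : Prop :=
  U `<=` open /\ \bigcup_(O in U) O = [set: X].

Definition lindelof_space (X : topologicalType) : Prop :=
  forall U : set (set X), open_cover U ->
    exists W : set (set X), [/\ W `<=` U, countable W & open_cover W].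

Definition frechet_space (X : topologicalType) : Prop :=
  forall (A : set X) (p : X), closure A p ->
    exists2 u : nat -> X, (forall n, A (u n)) & u @ \oo --> p.

Definition closed_discrete (X : topologicalType) (D : set X) : Prop :=
  closed D /\ D `<=` isolated D.

(* Two-player games of length omega; in each inning Alice moves first. The
   list argument of the legality predicates is the sequence of the innings
   already played. *)
Record game := Game {
  alice_move : Type;
  bob_move : Type;
  alice_legal : seq (alice_move * bob_move) -> alice_move -> Prop;
  bob_legal : seq (alice_move * bob_move) -> alice_move -> bob_move -> Prop;
  bob_wins : (nat -> alice_move * bob_move) -> Prop
}.

Section Strategies.
Variable G : game.
Implicit Type p : nat -> alice_move G * bob_move G.

Definition alice_legal_at p (n : nat) : Prop :=
  alice_legal (mkseq p n) (p n).1.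

Definition bob_legal_at p (n : nat) : Prop :=
  bob_legal (mkseq p n) (p n).1 (p n).2.

(* Alice's strategy sees Bob's moves in the previous innings. *)
Definition follows_alice (s : seq (bob_move G) -> alice_move G) p : Prop :=
  forall n, (p n).1 = s (mkseq (fun k => (p k).2) n).

(* Bob's strategy sees Alice's moves up to and including the current inning. *)
Definition follows_bob (t : seq (alice_move G) -> bob_move G) p : Prop :=
  forall n, (p n).2 = t (mkseq (fun k => (p k).1) n.+1).

(* A winning strategy must prescribe a legal move as long as the opponent has
   respected the rules, and must win every run in which the opponent always
   respects them. *)
Definition alice_winning (s : seq (bob_move G) -> alice_move G) : Prop :=
  forall p, follows_alice s p ->
    (forall n, (forall k, k < n -> bob_legal_at p k) -> alice_legal_at p n) /\
    ((forall n, bob_legal_at p n) -> ~ bob_wins p).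

Definition bob_winning (t : seq (alice_move G) -> bob_move G) : Prop :=
  forall p, follows_bob t p ->
    (forall n, (forall k, k <= n -> alice_legal_at p k) -> bob_legal_at p n) /\
    ((forall n, alice_legal_at p n) -> bob_wins p).

Definition alice_has_winning_strategy : Prop := exists s, alice_winning s.

Definition bob_has_winning_strategy : Prop := exists t, bob_winning t.

End Strategies.

Definition Menger_game (X : topologicalType) : game := {|
  alice_move := set (set X);
  bob_move := set (set X);
  alice_legal := fun _ U => open_cover U;
  bob_legal := fun _ U F => finite_set F /\ F `<=` U;
  bob_wins := fun p => \bigcup_n \bigcup_(O in (p n).2) O = [set: X]
|}.

(* The family {V_x : x in Y}; only the values of pona_nbhd on pona_dom = Y
   matter. *)
Record pona (X : topologicalType) := Pona {
  pona_dom : set X;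
  pona_nbhd : X -> set X
}.

Definition is_pona (X : topologicalType) (V : pona X) : Prop :=
  forall x, pona_dom V x -> open_nbhs x (pona_nbhd V x).

Definition pona_union (X : topologicalType) (V : pona X) (D : set X) : set X :=
  \bigcup_(x in D) pona_nbhd V x.

Definition pona_covered (X : topologicalType) (h : seq (pona X * set X)) :
    set X :=
  \big[setU/set0]_(m <- h) pona_union m.1 m.2.

(* In the first inning h = [::], so that ~` pona_covered h = [set: X]. *)
Definition PONAG (X : topologicalType) : game := {|
  alice_move := pona X;
  bob_move := set X;
  alice_legal := fun h V =>
    [/\ is_pona V,
        pona_dom V `<=` ~` pona_covered h
      & ~` pona_covered h `<=` pona_union V (pona_dom V)];
  bob_legal := fun _ V D => D `<=` pona_dom V /\ closed_discrete D;
  bob_wins := fun p => \bigcup_n pona_union (p n).1 (p n).2 = [set: X]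
|}.

(* Main.v *)
Require Import Defs.
From mathcomp Require Import all_boot.
From mathcomp Require Import all_classical.
From mathcomp Require Import topology.

Local Open Scope classical_set_scope.

(** A reduction of a game [G] to a game [H] translates Alice's moves from [G] to
    [H] and Bob's moves from [H] back to [G], preserving legality and Bob's
    victory; it carries winning strategies of Bob from [H] to [G] and those of
    Alice from [G] to [H]. Hence it suffices to reduce each game to the other.

    From PONAG to the Menger game, Alice's assignment becomes the cover
    [{V_x} u {the part already covered}], and Bob's finite subfamily becomes a
    finite, hence closed discrete, set of points.

    From the Menger game to PONAG, let [R] be the part not yet covered, a closed
    set. If [R] is uncountable, it is not discrete since [X] is Lindelof, so by
    the Frechet property some sequence in [R \ {p}] converges to some [p] in [R].
    Alice assigns the members of a countable subcover to the terms of this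
    sequence; a closed set of such terms involves only finitely many of them, so
    Bob's reply is dominated by a finite subfamily. If [R] is countable, Bob
    covers its points one after the other in the Menger game, whatever happens
    in PONAG. *)

(** * Transfer of winning strategies along a reduction *)

Section Reduction.
Context {G H : game}.

Let inning : Type := (alice_move G * bob_move G) * (alice_move H * bob_move H).

Variables (alpha : seq inning -> alice_move G -> alice_move H)
  (beta : seq inning -> alice_move G -> alice_move H -> bob_move H ->
    bob_move G).

(** Alice's move in [G] and Bob's move in [H] are the free inputs; the other two moves are their
    translations. *)
Definition parallel_inning (h : seq inning) (a : alice_move G)
    (b : bob_move H) : inning :=
  ((a, beta h a (alpha h a) b), (alpha h a, b)).

Definition parallel_run (r : nat -> inning) : Prop :=
  forall n, r n = parallel_inning (mkseq r n) (r n).1.1 (r n).2.2.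

(** Each legality clause assumes only what is known when the move is made, so the clauses can be
    chained by induction on the inning. *)
Definition reduction : Prop := forall r, parallel_run r ->
  let p := fst \o r in let q := snd \o r in
  [/\ forall n, (forall k, k <= n -> alice_legal_at p k) ->
        (forall k, k < n -> alice_legal_at q k) ->
        (forall k, k < n -> bob_legal_at q k) -> alice_legal_at q n,
      forall n, (forall k, k <= n -> alice_legal_at p k) ->
        (forall k, k <= n -> bob_legal_at q k) -> bob_legal_at p n
    & (forall n, alice_legal_at p n) -> (forall n, alice_legal_at q n) ->
        (forall n, bob_legal_at q n) -> bob_wins q -> bob_wins p].

Hypothesis red : reduction.

(** Bob runs [H] privately alongside [G], with [t] answering Alice's translated moves. His strategy
    sees only Alice's moves in [G], so it rebuilds both runs by a fold; [b0] is the default of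
    [last]. *)
Lemma bob_reduction (b0 : bob_move G) :
  bob_has_winning_strategy H -> bob_has_winning_strategy G.
Proof.
move=> [t t_win].
pose next h a :=
  parallel_inning h a (t (rcons [seq i.2.1 | i <- h] (alpha h a))).
pose state := foldl (fun h a => rcons h (next h a)) [::].
exists (fun s => last b0 [seq i.1.2 | i <- state s]) => p p_t.
pose h n := state (mkseq (fun k => (p k).1) n).
pose r n := next (h n) (p n).1.
have hS n : h n.+1 = rcons (h n) (r n) by rewrite /h mkseqS /state foldl_rcons.
have hE n : h n = mkseq r n by elim: n => // n IHn; rewrite hS mkseqS IHn.
have pE : p = fst \o r.
  apply/funext => n; rewrite [LHS]surjective_pairing p_t.
  by rewrite -/(h n.+1) hS map_rcons last_rcons.
have [] := red r; first by move=> n; rewrite -hE.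
rewrite -pE; set q := snd \o r => alice_qP bob_pP bob_winP.
have q_t : follows_bob t q.
  by move=> n; rewrite mkseqS /= hE -map_comp.
have [bob_qP q_win] := t_win q q_t.
have q_legal n : (forall k, k <= n -> alice_legal_at p k) ->
    alice_legal_at q n /\ bob_legal_at q n.
  (* The two legalities feed each other: [t] is legal against legal moves of Alice, and her
     translated moves are legal after legal play in [H]. *)
  elim/ltn_ind: n => n IHn p_legal.
  have IH k : k < n -> alice_legal_at q k /\ bob_legal_at q k.
    by move=> kn; apply: IHn => // j jk; apply/p_legal/(leq_trans jk)/ltnW.
  have qn : alice_legal_at q n by apply: alice_qP => // k /IH [].
  split=> //; apply: bob_qP => k.
  by rewrite leq_eqVlt => /predU1P [->//|/IH []].
split=> [n p_legal|p_legal].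
  apply: bob_pP => // k kn.
  by have [] := q_legal k (fun j jk => p_legal j (leq_trans jk kn)).
have {}q_legal n := q_legal n (fun k _ => p_legal k).
apply: bob_winP => // [n|n|]; try by have [] := q_legal n.
by apply: q_win => n; have [] := q_legal n.
Qed.

(** Dually, Alice imagines a run of [G] where [s] meets the translated replies, and plays the
    translations of its moves. *)
Lemma alice_reduction :
  alice_has_winning_strategy G -> alice_has_winning_strategy H.
Proof.
move=> [s s_win].
pose answer (h : seq inning) := s [seq i.1.2 | i <- h].
pose state := foldl (fun h b => rcons h (parallel_inning h (answer h) b)) [::].
exists (fun bs => let h := state bs in alpha h (answer h)) => q q_s.
pose h n := state (mkseq (fun k => (q k).2) n).
pose r n := parallel_inning (h n) (answer (h n)) (q n).2.
have hS n : h n.+1 = rcons (h n) (r n) by rewrite /h mkseqS /state foldl_rcons.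
have hE n : h n = mkseq r n by elim: n => // n IHn; rewrite hS mkseqS IHn.
have qE : q = snd \o r.
  by apply/funext => n; rewrite [LHS]surjective_pairing q_s.
have [] := red r; first by move=> n; rewrite -hE.
rewrite -qE; set p := fst \o r => alice_qP bob_pP bob_winP.
have p_s : follows_alice s p.
  by move=> n; rewrite /= /answer hE -map_comp.
have [alice_pP p_win] := s_win p p_s.
have legal n : (forall k, k < n -> bob_legal_at q k) ->
    alice_legal_at p n /\ alice_legal_at q n.
  elim/ltn_ind: n => n IHn q_legal.
  have IH k : k < n -> alice_legal_at p k /\ alice_legal_at q k.
    by move=> kn; apply: IHn => // j jk; apply/q_legal/(ltn_trans jk).
  have pn : alice_legal_at p n.
    apply: alice_pP => k kn; apply: bob_pP => j jk.
      by have [] := IH j (leq_ltn_trans jk kn).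
    by apply/q_legal/(leq_ltn_trans jk).
  split=> //; apply: alice_qP => // k; last by move=> /IH [].
  by rewrite leq_eqVlt => /predU1P [->//|/IH []].
split=> [n /legal []//|q_legal].
have {}legal n := legal n (fun k _ => q_legal k).
have p_legal n : alice_legal_at p n by have [] := legal n.
have aq_legal n : alice_legal_at q n by have [] := legal n.
by move=> /(bob_winP p_legal aq_legal q_legal); apply: p_win => n; apply: bob_pP.
Qed.

End Reduction.

(** * Finite sets, limit points and neighborhood assignments *)

Lemma finite_inj_le {T : Type} (A : set T) (f : T -> nat) (n : nat) :
  {in A &, injective f} -> finite_set [set x | A x /\ f x <= n].
Proof.
move=> f_inj; set S := [set x | _].
have <- : finite_set (f @` S) = finite_set S.
  apply/eq_finite_set/inj_card_eq => x y /set_mem [Ax _] /set_mem [Ay _].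
  by apply: f_inj; exact: mem_set.
by apply: sub_finite_set (finite_II n.+1) => _ [x [_ fx] <-].
Qed.

Section Topology.
Context {X : topologicalType}.

Lemma open_cover_point {U : set (set X)} (x : X) :
  open_cover U -> exists O, U O /\ O x.
Proof.
move=> [_ covU]; have : [set: X] x by [].
by rewrite -covU => -[O UO Ox]; exists O.
Qed.

Lemma finite_subcover {U : set (set X)} {K : set X} :
  open_cover U -> finite_set K ->
  exists F, [/\ finite_set F, F `<=` U & K `<=` \bigcup_(O in F) O].
Proof.
move=> covU finK.
have [c cP] := choice (fun x => open_cover_point x covU).
exists (c @` K); split; first exact: finite_image.
  by move=> _ [x _ <-]; case: (cP x).
by move=> x Kx; exists (c x); [exists x|case: (cP x)].
Qed.

Lemma finite_closed_discrete (D : set X) :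
  hausdorff_space X -> finite_set D -> closed_discrete D.
Proof.
move=> /hausdorff_accessible/accessible_finite_set_closed clF finD.
split; first exact: clF.
move=> x Dx; split; first exact/mem_set.
exists (~` (D `\ x)).
  apply: open_nbhs_nbhs; split; last by case=> _; apply.
  apply: closed_openC; apply: clF; exact: sub_finite_set (@subDsetl _ _ _) finD.
apply/seteqP; split=> [y [nDy Dy]|_ ->].
  by apply: contrapT => yx; apply: nDy.
by split=> // -[_]; apply.
Qed.

(** Otherwise each point of [R] has an open neighborhood meeting [R] only there; these and the
    complement of [R] cover [X]. Members of a countable subcover contain at most one point of [R]
    each, so [R] would be countable. *)
Lemma lindelof_closed_limit_point (R : set X) :
  lindelof_space X -> closed R -> ~ countable R ->
  exists2 p, R p & closure (R `\ p) p.
Proof.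
move=> linX clR; apply: contra_notP => noP.
have isoR x : exists O, R x -> [/\ open O, O x & O `&` R `<=` [set x]].
  case: (pselect (R x)) => [Rx|]; last by exists set0.
  exists (~` closure (R `\ x)) => _; split.
  - exact/closed_openC/closed_closure.
  - by move=> clx; apply: noP; exists x.
  - move=> y [ny Ry]; apply: contrapT => yx; apply: ny.
    by apply: subset_closure.
have [O OP] := choice isoR.
have [|W [WU /countable_injP [f f_inj] covW]] := linX ((O @` R) `|` [set ~` R]).
  split=> [_ [[x Rx <-]|->]|]; first by have [] := OP x Rx.
    exact: closed_openC.
  apply/seteqP; split=> // x _; case: (pselect (R x)) => Rx.
    by exists (O x); [left; exists x|have [] := OP x Rx].
  by exists (~` R) => //; right.
have [c cP] := choice (fun x => open_cover_point x covW).
apply/countable_injP; exists (f \o c) => x y /set_mem Rx /set_mem Ry fE.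
have [Wx cx] := cP x; have [Wy cy] := cP y.
have cE : c x = c y by apply: f_inj => //; exact: mem_set.
have [[z Rz zE]|cR] := WU _ Wx; last by rewrite cR in cx.
have [_ _ Oz] := OP z Rz.
have -> : x = z by apply: Oz; rewrite zE.
by have -> : y = z by apply: Oz; rewrite zE cE.
Qed.

Lemma pona_covered_mkseq (q : nat -> pona X * set X) (n : nat) :
  pona_covered (mkseq q n) = \bigcup_(k in `I_n) pona_union (q k).1 (q k).2.
Proof.
rewrite /pona_covered big_map bigcup_mkord
  -(big_mkord xpredT (fun k => pona_union (q k).1 (q k).2)).
by rewrite /index_iota subn0.
Qed.

(** Openness lets the covered part join a cover in the Menger game, and makes the remainder
    closed. *)
Lemma open_pona_covered (q : nat -> pona X * set X) (n : nat) :
  (forall k, k < n -> @alice_legal_at (PONAG X) q k) ->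
  (forall k, k < n -> @bob_legal_at (PONAG X) q k) ->
  open (pona_covered (mkseq q n)).
Proof.
move=> aq bq; rewrite pona_covered_mkseq.
apply: bigcup_open => k kn; apply: bigcup_open => x Dx.
by have [qk _ _] := aq k kn; have [Dk _] := bq k kn; have [] := qk x (Dk x Dx).
Qed.

(* A closed set of terms of a sequence misses its limit [p], hence contains
   only finitely many terms; attaching the [n]-th member of a countable
   subcover to the [n]-th term makes its neighborhoods use finitely many
   members of [U]. *)
Lemma uncountable_pona (R : set X) (U : set (set X)) :
  lindelof_space X -> frechet_space X -> closed R -> ~ countable R ->
  open_cover U ->
  exists V : pona X, [/\ is_pona V, pona_dom V `<=` R,
    R `<=` pona_union V (pona_dom V)
  & forall D, D `<=` pona_dom V -> closed D ->
    exists F, [/\ finite_set F, F `<=` U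
      & pona_union V D `<=` \bigcup_(O in F) O]].
Proof.
move=> linX freX clR uncR covU.
have [p Rp /freX [u uR u_p]] := lindelof_closed_limit_point R linX clR uncR.
have [W [WU /countable_injP [f f_inj] covW]] := linX U covU.
have [c cP] := choice (fun x => open_cover_point x covU).
(* [c x] puts [x] into [V x]; as [u] may repeat values, [x] also receives every [O] in [W] with
   [u (f O) = x]. *)
pose V x := c x `|` \bigcup_(O in [set O | W O /\ u (f O) = x]) O.
exists (@Pona X (range u) V); split=> /=.
- move=> x _; have [Ux cx] := cP x; split; last by left.
  apply: openU; first exact: (proj1 covU).
  by apply: bigcup_open => O [/WU UO _]; exact: (proj1 covU).
- by move=> _ [n _ <-]; case: (uR n).
- move=> x _; have [O [WO Ox]] := open_cover_point x covW.
  by exists (u (f O)); [exists (f O)|right; exists O].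
move=> D Du clD.
(* No term equals [p], so [D] misses [p] and the sequence eventually leaves [D]. *)
have [|N _ uN] := u_p (~` D).
  apply: open_nbhs_nbhs; split; first exact: closed_openC.
  by move=> /Du [n _ up]; have [_] := uR n; apply.
have uD n : D (u n) -> n <= N.
  by move=> Dn; rewrite leqNgt; apply/negP => /ltnW Nn; apply: (uN n).
exists ((c \o u) @` `I_N.+1 `|` [set O | W O /\ f O <= N]); split.
- rewrite finite_setU; split; first exact/finite_image/finite_II.
  exact: finite_inj_le.
- by move=> _ [[n _ <-]|[/WU//]]; have [] := cP (u n).
- move=> y [x Dx [cy|[O [WO fO] Oy]]].
    have [n _ un] := Du x Dx.
    exists (c x) => //; left; exists n; last by rewrite /= un.
    by rewrite /= ltnS; apply: uD; rewrite un.
  by exists O => //; right; split=> //; apply: uD; rewrite fO.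
Qed.

Lemma point_pona (R : set X) (U : set (set X)) :
  open_cover U ->
  exists V : pona X, [/\ is_pona V, pona_dom V `<=` R
  & R `<=` pona_union V (pona_dom V)].
Proof.
move=> covU; have [c cP] := choice (fun x => open_cover_point x covU).
exists (@Pona X R c); split=> // x Rx; last by exists x => //; case: (cP x).
by have [Ux cx] := cP x; split=> //; exact: (proj1 covU).
Qed.

End Topology.

(** * The two reductions *)

Lemma PONAG_Menger_reduction (X : topologicalType) :
  hausdorff_space X ->
  exists alpha beta, @reduction (PONAG X) (Menger_game X) alpha beta.
Proof.
move=> hX.
have pick (VF : pona X * set (set X)) : exists D, finite_set VF.2 ->
    [/\ finite_set D, D `<=` pona_dom VF.1
      & forall x, pona_dom VF.1 x -> VF.2 (pona_nbhd VF.1 x) ->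
        pona_nbhd VF.1 x `<=` pona_union VF.1 D].
  case: VF => V F /=.
  have [[x0 _]|domV0] := pselect (pona_dom V !=set0); last first.
    exists set0 => _; split; [exact: finite_set0|exact: sub0set|].
    by move=> x Vx; case: domV0; exists x.
  (* Infinitely many points may share a neighborhood, so one representative is kept per set; [x0] is
     a default. *)
  have rep O : exists x, (exists2 y, pona_dom V y & pona_nbhd V y = O) ->
      pona_dom V x /\ pona_nbhd V x = O.
    case: (pselect (exists2 y, pona_dom V y & pona_nbhd V y = O)) => [[y Vy yO]|nO].
      by exists y.
    by exists x0.
  have [g gP] := choice rep.
  exists (g @` (F `&` pona_nbhd V @` pona_dom V)) => finF; split.
  - exact/finite_image/finite_setIl.
  - by move=> _ [O [_ [y Vy <-]] <-]; case: (gP (pona_nbhd V y)) => //; exists y.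
  - move=> x Vx Fx z zx; have [|_ gE] := gP (pona_nbhd V x); first by exists x.
    exists (g (pona_nbhd V x)); last by rewrite gE.
    by exists (pona_nbhd V x) => //; split=> //; exists x.
have [d dP] := choice pick.
pose alpha (h : seq ((pona X * set X) * (set (set X) * set (set X)))) V :=
  pona_nbhd V @` pona_dom V `|` [set pona_covered (map fst h)].
exists alpha, (fun _ V _ F => d (V, F)) => r r_par p q.
have UE n : (q n).1 = pona_nbhd (p n).1 @` pona_dom (p n).1
    `|` [set pona_covered (mkseq p n)].
  by rewrite /q /= r_par /= /alpha -map_comp.
have DE n : (p n).2 = d ((p n).1, (q n).2) by rewrite /p /= r_par.
have bob_p n : @bob_legal_at (Menger_game X) q n -> @bob_legal_at (PONAG X) p n.
  move=> [/= finF _]; have [finD Ddom _] := dP ((p n).1, (q n).2) finF.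
  by split; rewrite /= DE //; apply: finite_closed_discrete.
split=> [n ap _ bq|n _ bq|ap _ bq win].
- have [V_pona _ Vcov] := ap n (leqnn n).
  rewrite /alice_legal_at /= UE; split=> [_ [[x Vx <-]|->]|].
  + by have [] := V_pona x Vx.
  + by apply: open_pona_covered => k kn; [apply/ap/ltnW|apply/bob_p/bq].
  apply/seteqP; split=> // x _.
  case: (pselect (pona_covered (mkseq p n) x)) => [cx|ncx].
    by exists (pona_covered (mkseq p n)) => //; right.
  have [y Vy Oy] := Vcov x ncx.
  by exists (pona_nbhd (p n).1 y) => //; left; exists y.
- exact/bob_p/bq.
- apply/seteqP; split=> // x _; have : [set: X] x by [].
  rewrite -[X in X x]win => -[n _ [O FO Ox]].
  have [finF FU] := bq n; have := FU O FO; rewrite UE => -[[y Vy yO]|OE].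
    exists n => //; rewrite DE.
    have [_ _ /(_ y Vy)] := dP ((p n).1, (q n).2) finF.
    by rewrite /= yO; apply.
  (* A point of the covered part was won in an earlier inning of PONAG. *)
  by move: Ox; rewrite OE pona_covered_mkseq => -[k _ xk]; exists k.
Qed.

Lemma Menger_PONAG_reduction (X : topologicalType) :
  lindelof_space X -> frechet_space X ->
  exists alpha beta, @reduction (Menger_game X) (PONAG X) alpha beta.
Proof.
move=> linX freX.
pose bounded (U : set (set X)) A := exists F,
  [/\ finite_set F, F `<=` U & A `<=` \bigcup_(O in F) O].
have translate (RU : set X * set (set X)) : exists V : pona X,
    closed RU.1 -> open_cover RU.2 ->
    [/\ is_pona V, pona_dom V `<=` RU.1, RU.1 `<=` pona_union V (pona_dom V)
      & ~ countable RU.1 -> forall D, D `<=` pona_dom V -> closed D ->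
        bounded RU.2 (pona_union V D)].
  case: RU => R U /=.
  case: (pselect (closed R)) => [clR|]; last by exists (@Pona X R (fun=> set0)).
  case: (pselect (open_cover U)) => [covU|]; last by exists (@Pona X R (fun=> set0)).
  case: (pselect (countable R)) => [cR|uncR].
    (* Only legality matters here: boundedness is asked for uncountable remainders alone. *)
    by have [V [? ? ?]] := point_pona R U covU; exists V.
  by have [V [? ? ? ?]] := uncountable_pona R U linX freX clR uncR covU; exists V.
have [tr trP] := choice translate.
have enumerate (R : set X) : exists f : X -> nat,
    countable R -> {in R &, injective f}.
  case: (pselect (countable R)) => [/countable_injP [f f_inj]|]; first by exists f.
  by exists (fun=> 0).
have [e eP] := choice enumerate.
(* [A] will be the part won by Bob's reply in PONAG and [K] the finite set of points due for
   covering; [F] takes care of [K] in any case, and of [A] whenever finitely many members can. *)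
have reply (UAK : set (set X) * (set X * set X)) : exists F,
    open_cover UAK.1 -> finite_set UAK.2.2 ->
    [/\ finite_set F, F `<=` UAK.1, UAK.2.2 `<=` \bigcup_(O in F) O
      & bounded UAK.1 UAK.2.1 -> UAK.2.1 `<=` \bigcup_(O in F) O].
  case: UAK => U [A K] /=.
  case: (pselect (open_cover U)) => [covU|]; last by exists set0.
  case: (pselect (finite_set K)) => [finK|]; last by exists set0.
  have [F [finF FU KF]] := finite_subcover covU finK.
  case: (pselect (bounded U A)) => [[F' [finF' F'U AF']]|]; last by exists F.
  exists (F `|` F') => _ _; split; first by rewrite finite_setU.
  - by move=> O [/FU|/F'U].
  - by move=> x /KF [O FO Ox]; exists O => //; left.
  - by move=> _ x /AF' [O FO Ox]; exists O => //; right.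
have [rep repP] := choice reply.
pose rest (h : seq ((set (set X) * set (set X)) * (pona X * set X))) :=
  ~` pona_covered (map snd h).
(* Bob's reply in inning [n] covers the points of index at most [n] of every
   countable remainder met so far. *)
pose early h := \bigcup_(k in `I_(size h).+1)
  [set x | countable (rest (take k h)) /\
    (rest (take k h) x /\ e (rest (take k h)) x <= size h)].
have early_fin h : finite_set (early h).
  apply: bigcup_finite => [|k _]; first exact: finite_II.
  case: (pselect (countable (rest (take k h)))) => [cR|ncR].
    apply: sub_finite_set (finite_inj_le _ _ (size h) (eP _ cR)).
    by move=> x [].
  by apply: sub_finite_set (finite_set0 _) => x [].
exists (fun h U => tr (rest h, U)),
  (fun h U V D => rep (U, (pona_union V D, early h))) => r r_par p q.
have restE n : rest (mkseq r n) = ~` pona_covered (mkseq q n).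
  by rewrite /rest -map_comp.
have VE n : (q n).1 = tr (~` pona_covered (mkseq q n), (p n).1).
  by rewrite /q /= r_par /= restE.
have FE n : (p n).2 =
    rep ((p n).1, (pona_union (q n).1 (q n).2, early (mkseq r n))).
  by rewrite /p /q /= r_par.
split=> [n ap aq bq|n ap bq|ap aq bq win].
- have clR : closed (~` pona_covered (mkseq q n)).
    exact/open_closedC/open_pona_covered.
  rewrite /alice_legal_at /= VE.
  by have [] := trP (~` pona_covered (mkseq q n), (p n).1) clR (ap n (leqnn n)).
- rewrite /bob_legal_at /= FE.
  by have [] := repP ((p n).1, (pona_union (q n).1 (q n).2, early (mkseq r n)))
    (ap n (leqnn n)) (early_fin _).
apply/seteqP; split=> // x _.
have F_spec n := repP ((p n).1, (pona_union (q n).1 (q n).2, early (mkseq r n)))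
    (ap n) (early_fin _).
case: (pselect (exists2 k, countable (~` pona_covered (mkseq q k)) &
    ~ pona_covered (mkseq q k) x)) => [[k cR Rx]|uncR].
  (* By inning [m] the remainder of inning [k] has been met and the index of [x] in it is at most
     [m]. *)
  pose m := maxn k (e (~` pona_covered (mkseq q k)) x).
  have [_ _ early_cov _] := F_spec m.
  exists m => //; rewrite FE; apply: early_cov.
  have takeE : take k (mkseq r m) = mkseq r k.
    by rewrite /mkseq -map_take take_iota (minn_idPl _) // leq_maxl.
  exists k; first by rewrite /= size_mkseq ltnS leq_maxl.
  by rewrite /= takeE restE size_mkseq leq_maxr.
(* Now every remainder containing [x] is uncountable. At the first inning whose PONAG reply covers
   [x], the remainder still contains [x], so that reply is bounded. *)
have ex_n : exists n, `[< pona_union (q n).1 (q n).2 x >].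
  have : [set: X] x by [].
  by rewrite -[X in X x]win => -[n _ xn]; exists n; apply/asboolP.
case: (ex_minnP ex_n) => n /asboolP xn n_min.
have Rx : ~ pona_covered (mkseq q n) x.
  rewrite pona_covered_mkseq => -[k /= kn xk].
  by have := n_min k (asboolT xk); rewrite leqNgt kn.
have [_ _ _ V_cov] := F_spec n.
exists n => //; rewrite FE; apply: V_cov => //=.
have clR : closed (~` pona_covered (mkseq q n)).
  exact/open_closedC/open_pona_covered.
have [_ _ _ V_bounded] := trP (~` pona_covered (mkseq q n), (p n).1) clR (ap n).
have [Ddom [Dcl _]] := bq n.
by rewrite VE in Ddom *; apply: V_bounded => // cR; apply: uncR; exists n.
Qed.

Theorem corollary5p9 (X : topologicalType)
  (X_infinite : infinite_set [set: X])
  (X_hausdorff : hausdorff_space X)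
  (X_lindelof : lindelof_space X)
  (X_frechet : frechet_space X) :
  (alice_has_winning_strategy (PONAG X) <->
   alice_has_winning_strategy (Menger_game X)) /\
  (bob_has_winning_strategy (PONAG X) <->
   bob_has_winning_strategy (Menger_game X)).
Proof.
have [a1 [b1 red1]] := PONAG_Menger_reduction X X_hausdorff.
have [a2 [b2 red2]] := Menger_PONAG_reduction X X_lindelof X_frechet.
split; split.
- exact: alice_reduction red1.
- exact: alice_reduction red2.
- exact: (bob_reduction _ _ red2 set0).
- exact: (bob_reduction _ _ red1 set0).
Qed.
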